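(* Let $H(x)>0$ ($x\ge 0$) be an $m\times m$ matrix function (a Hamiltonian), and let $A$, $S(0)$ be $n\times n$ matrices and $\Pi(0)$ an $n\times m$ matrix such that $S(0)>0$ and $$AS(0)-S(0)A^*=\mathrm{i}\,\Pi(0)\,j\,\Pi(0)^*.$$ Let the matrix functions $\Pi(x)$ ($n\times m$), $S(x)$ ($n\times n$) and $u(x)$ ($m\times m$), $x\ge0$, be determined by the given initial values $\Pi(0)$, $S(0)$ and by $$\Pi'(x)=-\mathrm{i}A\Pi(x)jH(x),\qquad S'(x)=\Pi(x)jH(x)j\Pi(x)^*,$$ $$u'(x)=-\widetilde q_0(x)u(x),\qquad u(0)=I_m,$$ where $$\widetilde q_0(x):=j\Pi(x)^*S(x)^{-1}\Pi(x)jH(x)-jH(x)j\Pi(x)^*S(x)^{-1}\Pi(x),$$ and set $\mathcal H(x):=u(x)^{-1}H(x)^{-1}\big(u(x)^*\big)^{-1}$. Assume that $jH^{-1}$ admits a representation $$jH(x)^{-1}=T(x)D(x)T(x)^{-1},$$ where $D(x)$ is some diagonal matrix function (and $T(x)$ is an invertible $m\times m$ matrix function). Then $$j\mathcal H(x)=\mathcal T(x)D(x)\mathcal T(x)^{-1}\qquad\text{for}\qquad \mathcal T(x)=\big(ju(x)j\big)^{-1}T(x).$$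
   Context: All matrices are complex; $n\in\mathbb N$; $m_1\ge0$, $m_2\ge0$, $m=m_1+m_2>0$; $I_p$ is the $p\times p$ identity matrix; $j=\begin{bmatrix} I_{m_1}&0\\0&-I_{m_2}\end{bmatrix}$. $M^*$ is the conjugate transpose of $M$, and $M>0$ (resp. $M\ge 0$) means $M$ is Hermitian positive definite (resp. positive semidefinite). A prime denotes $d/dx$. $\Pi$, $S$, $u$ are understood as (differentiable) solutions on $x\ge0$ of the stated differential equations. Since $S(0)>0$ and $S'(x)\ge0$, the matrices $S(x)$ are positive definite, hence invertible. *)

(* Defs.v *)
From mathcomp Require Import all_boot all_order all_algebra.
From mathcomp Require Import spectral sesquilinear complex.
From mathcomp Require Import all_classical all_reals all_analysis.
Import Order.TTheory GRing.Theory Num.Theory.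
Import numFieldNormedType.Exports.

Set Implicit Arguments.
Unset Strict Implicit.
Unset Printing Implicit Defensive.

Local Open Scope classical_set_scope.
Local Open Scope complex_scope.
Local Open Scope sesquilinear_scope.
Local Open Scope ring_scope.

Definition posdefmx (C : numClosedFieldType) (n : nat) (M : 'M[C]_n) : Prop :=
  M \is hermsymmx /\
  forall v : 'cV[C]_n, v != 0 -> 0 < (v ^t* *m M *m v) 0 0.

(* F has derivative F' on the half-line [0, +oo): the difference quotient is
   taken over the points of the half-line only, hence one-sided at 0, and
   values of F and F' at negative reals are irrelevant. The limit is taken in
   the entrywise topology of complex matrices; the alias R[i]^o is what carries
   the norm topology of the complex numbers. *)
Definition is_deriv_ge0 (R : realType) (p q : nat)
    (F F' : R -> 'M[R[i]]_(p, q)) : Prop :=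
  forall x : R, 0 <= x ->
    ((h^-1)%:C *: (F (x + h) - F x))
      @[h --> within [set h : R | 0 <= x + h] 0^'] --> (F' x : 'M[R[i]^o]_(p, q)).

Section Darboux.
Context (R : realType) (m1 m2 n : nat).
Local Notation C := (R[i]).
Local Notation m := (m1 + m2)%N.

Definition sigmx : 'M[C]_m := block_mx 1%:M 0 0 (- 1%:M).

Definition q0 (H : R -> 'M[C]_m) (Pi : R -> 'M[C]_(n, m)) (S : R -> 'M[C]_n)
    (x : R) : 'M[C]_m :=
  let X := (Pi x) ^t* *m invmx (S x) *m Pi x in
  sigmx *m X *m sigmx *m H x - sigmx *m H x *m sigmx *m X.

Definition transformed_ham (H u : R -> 'M[C]_m) (x : R) : 'M[C]_m :=
  invmx (u x) *m invmx (H x) *m invmx ((u x) ^t*).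

Definition transformed_diagonalizer (u T : R -> 'M[C]_m) (x : R) : 'M[C]_m :=
  invmx (sigmx *m u x *m sigmx) *m T x.

End Darboux.

Arguments sigmx {R m1 m2}.

(* Main.v *)
(** Since H and S(0) are Hermitian, S' is Hermitian and so is S(x). With
    X = Pi^* S^-1 Pi (again Hermitian), one has j q0 = X j H - H j X, which is
    skew-Hermitian; hence (u^* j u)' = - u^* (q0^* j + j q0) u = 0 and
    u^* j u = j on the whole half-line. Thus u is invertible with
    (u^* )^-1 = j u j, and conjugating the given diagonalization of j H^-1 by
    j u j gives the claim. *)

Require Import Defs.
From mathcomp Require Import all_boot all_order all_algebra.
From mathcomp Require Import spectral sesquilinear complex.
From mathcomp Require Import ring lra.
From mathcomp Require Import all_classical all_reals all_analysis.
Import Order.TTheory GRing.Theory Num.Theory.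
Import numFieldNormedType.Exports.

Set Implicit Arguments.
Unset Strict Implicit.

Local Open Scope complex_scope.
Local Open Scope sesquilinear_scope.
Local Open Scope classical_set_scope.
Local Open Scope ring_scope.

(** * One-sided differential calculus for complex scalar functions on the half-line *)

Definition scalar_deriv_ge0 (R : realType) (f f' : R -> R[i]) : Prop :=
  forall x : R, 0 <= x -> ((h^-1)%:C * (f (x + h) - f x))
    @[h --> within [set h : R | 0 <= x + h] 0^'] --> (f' x : R[i]^o).

Lemma scalar_deriv_entry (R : realType) p q (F F' : R -> 'M[R[i]]_(p, q)) i j :
  is_deriv_ge0 F F' -> scalar_deriv_ge0 (fun x => F x i j) (fun x => F' x i j).
Proof.
move=> dF x x0.
have := cvg_comp _ _ (dF x x0) (@coord_continuous R[i] p q i j (F' x)).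
apply: cvg_trans; apply: near_eq_cvg; near=> h.
by rewrite /= !mxE.
Unshelve. all: by end_near. Qed.

Section ScalarDerivative.
Variable R : realType.
Implicit Types f g : R -> R[i].

(** A form with real tolerances, convenient for conjugation and for passing to real parts. *)
Lemma scalar_deriv_ge0P f f' :
  scalar_deriv_ge0 f f' <-> forall x : R, 0 <= x -> forall e : R, 0 < e ->
    \forall h \near within [set h : R | 0 <= x + h] 0^',
      `|f' x - (h^-1)%:C * (f (x + h) - f x)| < e%:C.
Proof.
split=> df x x0.
  move=> e e0; have := (@cvgrPdist_lt _ R[i]^o _ _ _ _ _).1 (df x x0).
  by apply; rewrite ltcR.
apply/(@cvgrPdist_lt _ R[i]^o) => /= e e0.
(* The norm of [R[i]] takes values in [R[i]], so [e] is a priori complex; being positive, it is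
   real. *)
have -> : e = (complex.Re e)%:C by rewrite RRe_real // gtr0_real.
by apply: df => //; rewrite -ltcR RRe_real // gtr0_real.
Qed.

Lemma eq_scalar_deriv f g (f' g' : R -> R[i]) :
  f =1 g -> (forall x, 0 <= x -> f' x = g' x) ->
  scalar_deriv_ge0 f f' -> scalar_deriv_ge0 g g'.
Proof.
move=> fg fg' df x x0; rewrite -fg' //.
by have := df x x0; under eq_fun do rewrite !fg.
Qed.

Lemma scalar_deriv_cst (c : R[i]) : scalar_deriv_ge0 (fun=> c : R[i]) (fun=> 0).
Proof.
move=> x x0; under eq_fun do rewrite subrr mulr0.
exact: (cvg_cst (U := R[i]^o)).
Qed.

Lemma scalar_derivD f g f' g' :
  scalar_deriv_ge0 f f' -> scalar_deriv_ge0 g g' ->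
  scalar_deriv_ge0 (fun x => f x + g x) (fun x => f' x + g' x).
Proof.
move=> df dg x x0; apply: cvg_trans (cvgD (V := R[i]^o) (df x x0) (dg x x0)).
apply: near_eq_cvg; near=> h; rewrite fctE /= -mulrDr opprD addrACA.
Unshelve. all: by end_near. Qed.

Lemma scalar_deriv_sum (I : Type) (r : seq I) (f f' : I -> R -> R[i]) :
  (forall i, scalar_deriv_ge0 (f i) (f' i)) ->
  scalar_deriv_ge0 (fun x => \sum_(i <- r) f i x)
    (fun x => \sum_(i <- r) f' i x).
Proof.
move=> df; elim: r => [|i r IH].
  by apply: eq_scalar_deriv (scalar_deriv_cst 0) => x *; rewrite big_nil.
by apply: eq_scalar_deriv (scalar_derivD (df i) IH) => x *; rewrite big_cons.
Qed.

(** For [h != 0], [f (x + h)] is [f x] plus [h] times the difference quotient, and the second term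
    tends to [0 * f' x]. This continuity feeds the product rule. *)
Lemma scalar_deriv_continuous f f' x : scalar_deriv_ge0 f f' -> 0 <= x ->
  f (x + h) @[h --> within [set h : R | 0 <= x + h] 0^'] --> (f x : R[i]^o).
Proof.
move=> df x0.
have hC : (h%:C : R[i]^o)
    @[h --> within [set h : R | 0 <= x + h] 0^'] --> (0 : R[i]^o).
  apply/(@cvgrPdist_lt _ R[i]^o) => /= e e0.
  have -> : e = (complex.Re e)%:C by rewrite RRe_real // gtr0_real.
  have {}e0 : 0 < complex.Re e by rewrite -ltcR RRe_real // gtr0_real.
  apply: cvg_within; apply: nbhs_dnbhs; near=> h.
  rewrite sub0r normrN normc_def /= expr0n addr0 sqrtr_sqr ltcR.
  near: h; exact: (nbhs0_lt (V := R)).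
have -> : f x = f x + 0 * f' x by rewrite mul0r addr0.
apply: cvg_trans (cvgD (V := R[i]^o) (cvg_cst (U := R[i]^o) (f x))
  (cvgM (K := R[i]) hC (df x x0))).
apply: near_eq_cvg.
apply: cvg_within; near=> h.
have h0 : h != 0 by near: h; exact: nbhs_dnbhs_neq.
rewrite fctE /= mulrA -rmorphM /= divff // mul1r addrC subrK //.
Unshelve. all: by end_near. Qed.

(** The increment of the product splits as [(f (x + h) - f x) * g (x + h) + f x * (g (x + h) - g
    x)]; the shifted factor is where continuity of [g] enters. *)
Lemma scalar_derivM f g f' g' :
  scalar_deriv_ge0 f f' -> scalar_deriv_ge0 g g' ->
  scalar_deriv_ge0 (fun x => f x * g x) (fun x => f' x * g x + f x * g' x).
Proof.
move=> df dg x x0.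
apply: cvg_trans (cvgD (V := R[i]^o)
  (cvgM (K := R[i]) (df x x0) (scalar_deriv_continuous dg x0))
  (cvgM (K := R[i]) (cvg_cst (U := R[i]^o) (f x)) (dg x x0))).
apply: near_eq_cvg; near=> h.
rewrite fctE /=; ring.
Unshelve. all: by end_near. Qed.

(** Conjugation preserves the modulus and fixes the real factor [h^-1], so each estimate carries
    over unchanged. *)
Lemma scalar_deriv_conj f f' : scalar_deriv_ge0 f f' ->
  scalar_deriv_ge0 (fun x => (f x)^*) (fun x => (f' x)^*).
Proof.
move=> /scalar_deriv_ge0P df; apply/scalar_deriv_ge0P => x x0 e e0.
have := df x x0 e e0; apply: filterS => h.
rewrite -[X in X < _ -> _]norm_conjC rmorphB rmorphM rmorphB /=.
by rewrite (@conj_Creal _ (h^-1)%:C) // complex_real.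
Qed.

End ScalarDerivative.

(** * Zero derivative on the half-line implies constancy *)

Lemma Re_const_of_scalar_deriv0 (R : realType) (f : R -> R[i]) :
  scalar_deriv_ge0 f (fun=> 0) ->
  forall x, 0 <= x -> complex.Re (f x) = complex.Re (f 0).
Proof.
move=> /scalar_deriv_ge0P df x x0.
(* Freezing f at f 0 on the negative half-line turns the one-sided derivative
   into a two-sided one. *)
pose G (y : R) := complex.Re (f (Num.max y 0)).
have dG (y : R) : is_derive y (1 : R) G 0.
  suff lim0 : h^-1 *: (G (h *: (1 : R) + y) - G y)
      @[h --> (0 : R)^'] --> (0 : R).
    by apply: DeriveDef; [exact: cvgP lim0 | exact/cvg_lim].
  apply/cvgrPdist_lt => e e0.
  have z0 : 0 <= Num.max y 0 by rewrite le_max lexx orbT.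
  have := df _ z0 e e0.
  rewrite !near_withinE => /(nbhs_norm0P (V := R))[d /= d0 Hd].
  apply/(nbhs_norm0P (V := R)); exists d => //= h hd h0.
  (* [k] is the increment of the clamped argument. Clamping is 1-Lipschitz, so [k] stays within the
     radius [d], and it never leaves the half-line. *)
  pose k := Num.max (h + y) 0 - Num.max y 0.
  have kh : `|k| <= `|h|.
    have := ler_norm h; have := ler_norm (- h); rewrite normrN ler_norml /k.
    by case: (leP (h + y) 0); case: (leP y 0) => *; apply/andP; split; lra.
  have Gk : G (h *: 1 + y) = complex.Re (f (Num.max y 0 + k)).
    by rewrite /G /k [h *: 1]mulr1 addrCA subrr addr0.
  (* If [k] is zero, both points are clamped to the same value and the quotient of [G] is zero. *)
  have [k0|k0] := eqVneq k 0.
    by rewrite Gk k0 addr0 /G subrr scaler0 subrr normr0.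
  have {}Hd := Hd k (le_lt_trans kh hd) k0.
  have /Hd : 0 <= Num.max y 0 + k.
    by rewrite /k addrCA subrr addr0 le_max lexx orbT.
  rewrite sub0r normrN normrM => Hk.
  (* The real part is bounded by the modulus, so the increment of [G] is less than [e * |k|], hence
     less than [e * |h|]. *)
  have {Hk} :
      (`|k^-1| * `|complex.Re (f (Num.max y 0 + k) - f (Num.max y 0))|)%:C < e%:C.
    apply: le_lt_trans Hk; rewrite rmorphM /= [X in _ <= X * _]normc_def /=.
    rewrite expr0n addr0 sqrtr_sqr ler_wpM2l ?normc_ge_Re //.
    by rewrite (lecR 0).
  rewrite ltcR normfV mulrC ltr_pdivrMr ?normr_gt0 // => Hk.
  rewrite sub0r normrN normrZ normfV mulrC ltr_pdivrMr ?normr_gt0 //.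
  rewrite Gk /G -raddfB; apply: lt_le_trans Hk _.
  by rewrite ler_wpM2l // ltW.
have := is_derive_0_is_cst x 0 dG.
by rewrite /G maxxx (max_idPl x0).
Qed.

(** The imaginary part is reached by applying the real-part result to [f * 'i], whose real part is
    minus the imaginary part of [f]. *)
Lemma const_of_scalar_deriv0 (R : realType) (f : R -> R[i]) :
  scalar_deriv_ge0 f (fun=> 0) -> forall x, 0 <= x -> f x = f 0.
Proof.
move=> df x x0.
have dif : scalar_deriv_ge0 (fun x => f x * 'i%C) (fun=> 0).
  apply: eq_scalar_deriv (scalar_derivM df (scalar_deriv_cst 'i%C)) => // y _.
  by rewrite mul0r mulr0 addr0.
have := Re_const_of_scalar_deriv0 dif x0; rewrite !ReiNIm => /oppr_inj Imf.
by apply/eqP; rewrite eq_complex (Re_const_of_scalar_deriv0 df x0) Imf !eqxx.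
Qed.

(** * Matrix calculus on the half-line, reduced entry by entry to the scalar rules *)

Definition entrywise_deriv_ge0 (R : realType) p q
    (F F' : R -> 'M[R[i]]_(p, q)) :=
  forall i j, scalar_deriv_ge0 (fun x => F x i j) (fun x => F' x i j).

Section MatrixDerivative.
Variable R : realType.

Lemma eq_entrywise_deriv p q (F F' G' : R -> 'M[R[i]]_(p, q)) :
  (forall x, 0 <= x -> F' x = G' x) ->
  entrywise_deriv_ge0 F F' -> entrywise_deriv_ge0 F G'.
Proof.
by move=> E dF i j; apply: eq_scalar_deriv (dF i j) => // x x0; rewrite E.
Qed.

Lemma entrywise_deriv_cst p q (M : 'M[R[i]]_(p, q)) :
  entrywise_deriv_ge0 (fun=> M) (fun=> 0).
Proof.
move=> i j; apply: eq_scalar_deriv (scalar_deriv_cst (M i j)) => // x _.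
by rewrite mxE.
Qed.

Lemma entrywise_derivM p q r (F F' : R -> 'M[R[i]]_(p, q))
    (G G' : R -> 'M[R[i]]_(q, r)) :
  entrywise_deriv_ge0 F F' -> entrywise_deriv_ge0 G G' ->
  entrywise_deriv_ge0 (fun x => F x *m G x)
    (fun x => F' x *m G x + F x *m G' x).
Proof.
move=> dF dG i j.
have := scalar_deriv_sum (r := index_enum 'I_q)
  (fun k => scalar_derivM (dF i k) (dG k j)).
apply: eq_scalar_deriv => x *; rewrite !mxE //.
by rewrite big_split.
Qed.

Lemma entrywise_deriv_adj p q (F F' : R -> 'M[R[i]]_(p, q)) :
  entrywise_deriv_ge0 F F' ->
  entrywise_deriv_ge0 (fun x => (F x)^t*) (fun x => (F' x)^t*).
Proof.
move=> dF i j.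
by apply: eq_scalar_deriv (scalar_deriv_conj (dF j i)) => x *; rewrite !mxE.
Qed.

Lemma entrywise_derivB p q (F F' G G' : R -> 'M[R[i]]_(p, q)) :
  entrywise_deriv_ge0 F F' -> entrywise_deriv_ge0 G G' ->
  entrywise_deriv_ge0 (fun x => F x - G x) (fun x => F' x - G' x).
Proof.
move=> dF dG i j.
apply: eq_scalar_deriv (scalar_derivD (dF i j)
  (scalar_derivM (scalar_deriv_cst (-1)) (dG i j))) => x *.
  by rewrite !mxE mulN1r.
by rewrite !mxE mul0r add0r mulN1r.
Qed.

Lemma const_of_entrywise_deriv0 p q (F : R -> 'M[R[i]]_(p, q)) :
  entrywise_deriv_ge0 F (fun=> 0) -> forall x, 0 <= x -> F x = F 0.
Proof.
move=> dF x x0; apply/matrixP => i j.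
apply: (@const_of_scalar_deriv0 _ (fun x => F x i j)) x0.
by apply: eq_scalar_deriv (dF i j) => // y _; rewrite mxE.
Qed.

End MatrixDerivative.

(** * Algebra of the conjugate transpose *)

Section Adjoint.
Variable C : numClosedFieldType.

Lemma adjM p q r (A : 'M[C]_(p, q)) (B : 'M[C]_(q, r)) :
  (A *m B)^t* = B^t* *m A^t*.
Proof. by rewrite trmx_mul map_mxM. Qed.

Lemma adjK p q (A : 'M[C]_(p, q)) : (A^t*)^t* = A.
Proof. by apply/matrixP => i j; rewrite !mxE conjCK. Qed.

Lemma adjB p q (A B : 'M[C]_(p, q)) : (A - B)^t* = A^t* - B^t*.
Proof. by rewrite linearB map_mxB. Qed.

Lemma adjN p q (A : 'M[C]_(p, q)) : (- A)^t* = - A^t*.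
Proof. by rewrite linearN map_mxN. Qed.

(** This covers singular [A] as well: there [invmx] returns its argument, and the adjoint is
    singular too. *)
Lemma adj_invmx n (A : 'M[C]_n) : (invmx A)^t* = invmx (A^t*).
Proof. by rewrite trmx_inv map_invmx. Qed.

Lemma adj_posdefmx n (A : 'M[C]_n) : posdefmx A -> A^t* = A.
Proof. by case=> /is_hermitianmxP; rewrite expr0 scale1r => <-. Qed.

End Adjoint.

Lemma invmx_eq (C : comUnitRingType) n (A B : 'M[C]_n) :
  A *m B = 1%:M -> invmx A = B.
Proof.
move=> AB; have [uA _] := mulmx1_unit AB.
by rewrite -[RHS](mulKmx uA) AB mulmx1.
Qed.

(** * The signature matrix is a Hermitian involution *)

Section Signature.
Variables (R : realType) (m1 m2 : nat).
Local Notation j := (@sigmx R m1 m2).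

Lemma sigmx_sqr : j *m j = 1%:M.
Proof.
rewrite /sigmx mulmx_block !(mul0mx, mulmx0, mulmx1, mul1mx) mulNmx mulmxN.
by rewrite mul1mx opprK !(addr0, add0r) -scalar_mx_block.
Qed.

Lemma sigmx_adj : j^t* = j.
Proof.
by rewrite /sigmx tr_block_mx map_block_mx adjN !trmx0 !trmx1 !map_mx0 !map_mx1.
Qed.

Lemma sigmx_unit : j \in unitmx.
Proof. by have [] := mulmx1_unit sigmx_sqr. Qed.

End Signature.

(** * Conserved quantities of the differential system *)

Section Darboux.
Variables (R : realType) (m1 m2 n : nat).
Variables (H u : R -> 'M[R[i]]_(m1 + m2)).
Variables (Pi : R -> 'M[R[i]]_(n, m1 + m2)) (S : R -> 'M[R[i]]_n).
Local Notation j := (@sigmx R m1 m2).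
Hypothesis H_adj : forall x, 0 <= x -> (H x)^t* = H x.

(** The difference [S^* - S] vanishes at 0 and has zero derivative, because [Pi j H j Pi^*] equals
    its own adjoint. *)
Lemma S_adj : (S 0)^t* = S 0 ->
  is_deriv_ge0 S (fun x => Pi x *m j *m H x *m j *m (Pi x)^t*) ->
  forall x, 0 <= x -> (S x)^t* = S x.
Proof.
move=> S0 dS x x0.
have /(entrywise_deriv_adj (F := S)) dSa :=
  fun i k => scalar_deriv_entry (i := i) (j := k) dS.
have := const_of_entrywise_deriv0 (F := fun x => (S x)^t* - S x) _ x0.
rewrite S0 subrr => /(_ _)/subr0_eq; apply.
apply: eq_entrywise_deriv
  (entrywise_derivB dSa
    (fun i k => scalar_deriv_entry (i := i) (j := k) dS)) => y y0.
by rewrite !adjM adjK sigmx_adj H_adj // !mulmxA subrr.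
Qed.

Lemma u_sigmx_unitary : (forall x, 0 <= x -> (S x)^t* = S x) -> u 0 = 1%:M ->
  is_deriv_ge0 u (fun x => - q0 H Pi S x *m u x) ->
  forall x, 0 <= x -> (u x)^t* *m j *m u x = j.
Proof.
move=> Sa u0 du x x0.
have du' : entrywise_deriv_ge0 u (fun x => - q0 H Pi S x *m u x).
  by move=> i k; exact: scalar_deriv_entry du.
have -> : (u x)^t* *m j *m u x = (u 0)^t* *m j *m u 0; last first.
  by rewrite u0 trmx1 map_mx1 mul1mx mulmx1.
apply: (const_of_entrywise_deriv0 (F := fun x => (u x)^t* *m j *m u x)) x0.
apply: eq_entrywise_deriv (entrywise_derivM (entrywise_derivM
  (entrywise_deriv_adj du') (entrywise_deriv_cst j)) du') => y y0.
rewrite mulmx0 addr0 /q0; set X := _ *m invmx _ *m _.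
have Xa : X^t* = X by rewrite /X !adjM adjK adj_invmx Sa // mulmxA.
move: X Xa => X Xa; rewrite !mulNmx adjN adjM adjB !adjM sigmx_adj H_adj // Xa.
set P := _ - _; set Q := _ - _.
(* Here [P] is the adjoint of [q0] and [Q] is [q0]. Since [j j = 1], the sum is
   [(H j X - X j H) + (X j H - H j X)]. *)
have PQ : P *m j + j *m Q = 0.
  rewrite /P /Q mulmxBl mulmxBr !mulmxA sigmx_sqr !mul1mx.
  by rewrite -!(mulmxA _ j j) sigmx_sqr !mulmx1 addrC addrA subrK subrr.
transitivity (- ((u y)^t* *m (P *m j + j *m Q) *m u y)).
  by rewrite mulmxDr mulmxDl opprD !(mulmxA, mulNmx, mulmxN).
by rewrite PQ mulmx0 mul0mx oppr0.
Qed.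

End Darboux.

(** * Transport of the diagonalization to the transformed Hamiltonian *)

Unset Implicit Arguments.
Set Strict Implicit.

Theorem theorem3p6 (R : realType) (m1 m2 n : nat) (hm : (0 < m1 + m2)%N)
    (H : R -> 'M[R[i]]_(m1 + m2)) (A : 'M[R[i]]_n)
    (Pi : R -> 'M[R[i]]_(n, m1 + m2)) (S : R -> 'M[R[i]]_n)
    (u T D : R -> 'M[R[i]]_(m1 + m2))
    (hH : forall x : R, 0 <= x -> posdefmx (H x))
    (hS0 : posdefmx (S 0))
    (hid : A *m S 0 - S 0 *m A ^t* = 'i *: (Pi 0 *m sigmx *m (Pi 0) ^t*))
    (hPi : is_deriv_ge0 Pi (fun x => - 'i *: (A *m Pi x *m sigmx *m H x)))
    (hS : is_deriv_ge0 S
            (fun x => Pi x *m sigmx *m H x *m sigmx *m (Pi x) ^t*))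
    (hu : is_deriv_ge0 u (fun x => - q0 H Pi S x *m u x))
    (hu0 : u 0 = 1%:M)
    (hT : forall x : R, 0 <= x -> T x \in unitmx)
    (hD : forall x : R, 0 <= x -> is_diag_mx (D x))
    (hHT : forall x : R, 0 <= x ->
       sigmx *m invmx (H x) = T x *m D x *m invmx (T x)) :
  forall x : R, 0 <= x ->
    u x \in unitmx /\
    sigmx *m transformed_ham H u x =
      transformed_diagonalizer u T x *m D x
        *m invmx (transformed_diagonalizer u T x).
Proof.
move=> x x0; set j := sigmx.
have H_adj y : 0 <= y -> (H y)^t* = H y by move=> y0; exact/adj_posdefmx/hH.
have uju : (u x)^t* *m j *m u x = j.
  apply: (u_sigmx_unitary H_adj _ hu0 hu) x0.
  exact: S_adj H_adj (adj_posdefmx hS0) hS.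
have jj : j *m j = 1%:M := sigmx_sqr _ _ _.
have uU : u x \in unitmx.
  (* Multiplying [u^* j u = j] by [j] on the left exhibits [j u^* j] as a left inverse of [u]; for
     square matrices this suffices. *)
  by have := congr1 (mulmx j) uju; rewrite jj !mulmxA => /mulmx1_unit[].
split=> //.
have adj_inv : invmx ((u x)^t*) = j *m u x *m j.
  by apply: invmx_eq; rewrite !mulmxA uju.
have winv : invmx (j *m u x *m j) = j *m invmx (u x) *m j.
  apply: invmx_eq; rewrite -!mulmxA (mulmxA j j) jj mul1mx.
  by rewrite (mulmxA (u x)) mulmxV // mul1mx jj.
have Tinv : invmx (transformed_diagonalizer u T x) =
    invmx (T x) *m (j *m u x *m j).
  apply: invmx_eq; rewrite /transformed_diagonalizer -/j -(mulmxA _ (T x)).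
  rewrite (mulmxA (T x)) (mulmxV (hT x x0)) mul1mx mulVmx //.
  by rewrite !unitmx_mul sigmx_unit uU.
(* Inserting [j j = 1] between the inverses of [u] and [H] exposes the factor [j H^-1], to which the
   given diagonalization applies; the outer factors are the inverse of [j u j] and [j u j]
   itself. *)
transitivity (j *m invmx (u x) *m (j *m j) *m invmx (H x) *m (j *m u x *m j)).
  by rewrite jj mulmx1 /transformed_ham adj_inv !mulmxA.
transitivity (j *m invmx (u x) *m j *m (j *m invmx (H x)) *m (j *m u x *m j)).
  by rewrite !mulmxA.
by rewrite hHT // Tinv /transformed_diagonalizer -/j winv !mulmxA.
Qed.
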